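(* Let $s\ge 1$ be an integer and let $M>0$. Let $\bar{\bm c}=(\bar c_i)_{i=0}^s$ be the node distribution consisting of the scaled Chebyshev nodes, indexed in increasing order: $$\bar c_i=-\frac{\cos\left(\frac{2i+1}{2(s+1)}\pi\right)}{\cos\left(\frac{\pi}{2(s+1)}\right)},\qquad i=0,\dots,s.$$ Then $\bar{\bm c}$ is the solution to the problem $$\min_{\bm c\in\mathcal C}\ \sup_{f\in C_M^{s+1}}\|f-L_{\bm c}(f)\|_\infty ,$$ that is, $\bar{\bm c}\in\mathcal C$ and $$\sup_{f\in C_M^{s+1}}\|f-L_{\bar{\bm c}}(f)\|_\infty=\min_{\bm c\in\mathcal C}\ \sup_{f\in C_M^{s+1}}\|f-L_{\bm c}(f)\|_\infty .$$
   Context: $\mathcal C$ is the set of node distributions on $[-1,1]$ with $s+1$ nodes that include the endpoints: $\mathcal C=\{\bm c=(c_i)_{i=0}^s:\ -1=c_0<c_1<\dots<c_{s-1}<c_s=1\}$. For $\bm c\in\mathcal C$ and a function $f:[-1,1]\to\mathbb R$, $L_{\bm c}(f)$ denotes the Lagrange interpolation polynomial of $f$ over the nodes $(c_i)_{i=0}^s$, i.e. the unique polynomial of degree at most $s$ with $L_{\bm c}(f)(c_i)=f(c_i)$ for $i=0,\dots,s$. $C_M^{s+1}=\{f\in C^{s+1}[-1,1]:\ \max_{x\in[-1,1]}|f^{(s+1)}(x)|\le M\}$ (real-valued functions). $\|g\|_\infty=\sup_{x\in[-1,1]}|g(x)|$. *)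

(* Defs.v *)
From HB Require Import structures.
From mathcomp Require Import all_boot all_order all_algebra.
From mathcomp Require Import all_classical all_reals all_analysis.
Set Implicit Arguments.
Unset Strict Implicit.
Unset Printing Implicit Defensive.
Import Order.TTheory GRing.Theory Num.Theory.
Import numFieldNormedType.Exports.
Local Open Scope classical_set_scope.
Local Open Scope ring_scope.

(* Functions on [-1, 1] are represented by total functions R -> R; [CnM],
   [sup_norm], [worst_error], and [lagrange_interp] on admissible nodes, only
   depend on their values on [-1, 1]. *)
Definition segm (R : realType) : set R := `[(-1 : R), 1].
Arguments segm : clear implicits.

Definition sup_norm (R : realType) (g : R -> R) : \bar R :=
  ereal_sup [set (`|g x|)%:E | x in segm R].

(* Difference quotient of f at x along y -> x with y in A and y != x; for
   A = [a, b] this is the two-sided derivative at interior points and the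
   one-sided derivative at a and b.  ['D_1 f] and [f^`()] are not suitable
   here: at the end points they depend on values of f outside A. *)
Definition diffquo (R : realType) (f : R -> R) (x y : R) : R :=
  (f y - f x) / (y - x).

Definition derivable_within (R : realType) (A : set R) (f : R -> R) (x : R) :=
  cvg (diffquo f x y @[y --> within A x^']).

Definition derive_within (R : realType) (A : set R) (f : R -> R) (x : R) : R :=
  lim (diffquo f x y @[y --> within A x^']).

Definition deriven_within (R : realType) (A : set R) (n : nat) (f : R -> R) :
    R -> R :=
  iter n (derive_within A) f.

Definition Cn_segm (R : realType) (n : nat) : set (R -> R) :=
  [set f | (forall k, (k < n)%N -> forall x, segm R x ->
              derivable_within (segm R) (deriven_within (segm R) k f) x)
           /\ {within segm R, continuous (deriven_within (segm R) n f)}].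

Definition CnM (R : realType) (n : nat) (M : R) : set (R -> R) :=
  [set f | Cn_segm n f
           /\ (sup_norm (deriven_within (segm R) n f) <= M%:E)%E].

Definition nodes (R : realType) (s : nat) : set ('I_s.+1 -> R) :=
  [set c | [/\ c ord0 = -1, c ord_max = 1 &
               forall i j : 'I_s.+1, (i < j)%N -> c i < c j]].

(* [x.-lagrange_ i] of qpoly requires the sampling points to be given by an
   injective sequence nat -> R, whereas node distributions are finite. *)
Definition lagrange_interp (R : realType) (s : nat) (c : 'I_s.+1 -> R)
    (f : R -> R) : {poly R} :=
  \sum_(i < s.+1) f (c i) *:
    \prod_(j < s.+1 | j != i) ((c i - c j)^-1 *: ('X - (c j)%:P)).

Section lagrange_interp_spec.
Variables (R : realType) (s : nat) (c : 'I_s.+1 -> R) (f : R -> R).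

Lemma size_lagrange_interp : (size (lagrange_interp c f) <= s.+1)%N.
Proof.
apply: (leq_trans (size_sum _ _ _)); apply/bigmax_leqP => i _.
apply: (leq_trans (size_scale_leq _ _)).
rewrite scaler_prod; apply: (leq_trans (size_scale_leq _ _)).
have -> : \prod_(j < s.+1 | j != i) ('X - (c j)%:P) =
          \prod_(j <- enum (predC1 i)) ('X - (c j)%:P).
  by rewrite big_enum.
by rewrite size_prod_XsubC -cardE cardC1 card_ord.
Qed.

Lemma lagrange_interp_sample (cN : nodes c) (k : 'I_s.+1) :
  (lagrange_interp c f).[c k] = f (c k).
Proof.
case: cN => _ _ cI.
have c_inj (i j : 'I_s.+1) : i != j -> c i - c j != 0.
  rewrite subr_eq0 => /eqP ij; have [/cI|/cI|/val_inj//] := ltngtP i j.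
    by move/lt_eqF => ->.
  by move/gt_eqF => ->.
rewrite /lagrange_interp horner_sum (bigD1 k)//= [X in _ + X]big1 ?addr0 => [|i ik].
  rewrite hornerZ horner_prod big1 ?mulr1// => j jk.
  by rewrite hornerZ hornerXsubC mulVf// c_inj// eq_sym.
rewrite hornerZ horner_prod (bigD1 k) 1?eq_sym//=.
by rewrite hornerZ hornerXsubC subrr mulr0 mul0r mulr0.
Qed.

Lemma lagrange_interp_uniq (cN : nodes c) (p : {poly R}) :
  (size p <= s.+1)%N -> (forall k, p.[c k] = f (c k)) ->
  p = lagrange_interp c f.
Proof.
move=> sp pf; apply/eqP; rewrite -subr_eq0; apply/eqP.
apply: (@roots_geq_poly_eq0 _ _ [seq c i | i <- enum 'I_s.+1]).
- apply/allP => _ /mapP[k _ ->].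
  by rewrite rootE hornerD hornerN pf lagrange_interp_sample// subrr.
- rewrite map_inj_uniq ?enum_uniq// => i j; case: cN => _ _ cI cij.
  by have [/cI|/cI|/val_inj//] := ltngtP i j; rewrite cij ltxx.
- rewrite size_map size_enum_ord (leq_trans (size_polyD _ _))//.
  by rewrite size_polyN geq_max sp size_lagrange_interp.
Qed.

End lagrange_interp_spec.

Definition worst_error (R : realType) (s : nat) (M : R) (c : 'I_s.+1 -> R) :
    \bar R :=
  ereal_sup [set sup_norm (fun x => f x - (lagrange_interp c f).[x])
            | f in CnM s.+1 M].

Definition cheb_nodes (R : realType) (s : nat) : 'I_s.+1 -> R := fun i =>
  - (cos ((2 * i + 1)%:R / (2 * s.+1)%:R * pi) / cos (pi / (2 * s.+1)%:R)).

(* Main.v *)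
Require Import Defs.
From mathcomp Require Import all_boot all_order all_algebra.
From mathcomp Require Import all_classical all_reals all_analysis.
From mathcomp Require Import ring lra zify polyrcf.
Import Order.TTheory GRing.Theory Num.Theory.
Import numFieldNormedType.Exports.
Local Open Scope classical_set_scope.
Local Open Scope ring_scope.

(** Write n = s + 1, w_c for the monic polynomial of degree n whose roots are
    the nodes c_i, and |w_c| for the maximum of its absolute value on [-1, 1].
    The worst error of the nodes c is exactly M / n! * |w_c|.  It is at most
    that because of the Cauchy form of the remainder,
      f x - L_c f x = f^(n)(xi) / n! * w_c x  for some xi,
    which follows from Rolle's theorem applied n times ([interp_error],
    [worst_error_le]); it is at least that because the polynomial
    f = M / n! * w_c has constant n-th derivative M and is interpolated by 0
    ([worst_error_ge]).

    It remains to minimise |w_c| over monic polynomials of degree n having all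
    their roots in [-1, 1] and vanishing at both end points.  Let T_n be the
    Chebyshev polynomial, T_n (cos t) = cos (n t), and let
    a = cos (pi / (2 n)) be its largest root.  The scaled Chebyshev nodes are
    the roots of T_n (a x), so that their node polynomial is kappa * T_n (a x)
    with kappa = 1 / (2^s a^n), and it is bounded by kappa on [-1, 1]
    ([horner_node_poly_cheb], [node_poly_cheb_le]).  It takes the values
    (-1)^j kappa at the s points y_j = cos (j pi / n) / a, 1 <= j <= s, which
    lie in ]-1, 1[.  If some admissible c had |w_c| < kappa, the difference of
    the two node polynomials would have degree at most s, would vanish at -1
    and 1, and would alternate in sign at the y_j, hence have s - 1 further
    roots between them: too many ([alternation_absurd],
    [node_poly_ge]). *)

Set Implicit Arguments.
Unset Strict Implicit.
Unset Printing Implicit Defensive.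

(** * Derivatives within [-1, 1] and iterated Rolle *)

Section WithinDerivative.
Context {R : realType}.
Implicit Types (f g : R -> R) (p : {poly R}) (x y l : R).

Lemma segmE x : segm R x = (-1 <= x <= 1) :> Prop.
Proof. by rewrite /segm /= in_itv. Qed.

Definition is_derive_within f x l :=
  diffquo f x y @[y --> within (segm R) x^'] --> l.

(** Every point of [-1, 1], end points included, is a limit of other points of
    [-1, 1]; this makes the derivative within [-1, 1] unique there. *)
Lemma segm_dnbhs_proper x : segm R x -> ProperFilter (within (segm R) x^').
Proof.
rewrite segmE => /andP[x1 x2].
apply: Build_ProperFilter_ex => P /=.
move=> /nbhs_ballP[e /= e0 eP].
have [d [d0 de d1]] : exists d, [/\ 0 < d, d < e & d <= 1].
  exists (Num.min e 1 / 2); rewrite divr_gt0 ?lt_min ?e0 ?ltr01//.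
  have : Num.min e 1 <= e by rewrite ge_min lexx.
  have : Num.min e 1 <= 1 by rewrite ge_min lexx orbT.
  by split=> //; lra.
have [x0|x0] := leP x 0.
- exists (x + d); apply: eP.
  + by rewrite /ball /= opprD addrA subrr sub0r normrN gtr0_norm.
  + by apply/eqP; lra.
  + by rewrite segmE; lra.
- exists (x - d); apply: eP.
  + by rewrite /ball /= opprB addrC subrK gtr0_norm.
  + by apply/eqP; lra.
  + by rewrite segmE; lra.
Qed.

Lemma is_derive_within_lim f x l : segm R x -> is_derive_within f x l ->
  derive_within (segm R) f x = l.
Proof.
move=> /segm_dnbhs_proper xP fl; exact: cvg_lim.
Qed.

Lemma derivable_within_is_derive_within f x : derivable_within (segm R) f x ->
  is_derive_within f x (derive_within (segm R) f x).
Proof. by []. Qed.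

Lemma eq_is_derive_within f g x l : {in segm R, f =1 g} -> segm R x ->
  is_derive_within f x l -> is_derive_within g x l.
Proof.
move=> fg Sx; apply: cvg_trans; apply: near_eq_cvg.
rewrite near_withinE; near=> y => Sy.
by rewrite /diffquo !fg// inE.
Unshelve. all: by end_near. Qed.

Lemma is_derive_withinB f g x a b :
  is_derive_within f x a -> is_derive_within g x b ->
  is_derive_within (fun y => f y - g y) x (a - b).
Proof.
move=> fa gb; rewrite /is_derive_within.
rewrite (_ : diffquo _ x = (fun y => diffquo f x y - diffquo g x y)); last first.
  by apply/funext => y; rewrite /diffquo -mulrBl; congr (_ / _); ring.
exact: cvgB.
Qed.

Lemma is_derive_withinZ f x k l : is_derive_within f x l ->
  is_derive_within (fun y => f y * k) x (l * k).
Proof.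
move=> fl; rewrite /is_derive_within.
rewrite (_ : diffquo _ x = (fun y => diffquo f x y * k)); last first.
  by apply/funext => y; rewrite /diffquo mulrAC -mulrBl.
exact: cvgMl.
Qed.

(** By the factor theorem the difference quotient of p at x is a polynomial
    q, continuous at x, and q.[x] is the formal derivative of p at x. *)
Lemma is_derive_within_horner p x : is_derive_within (horner p) x p^`().[x].
Proof.
have /factor_theorem[q pq] : root (p - p.[x]%:P) x.
  by rewrite rootE hornerD hornerN hornerC subrr.
have -> : p^`().[x] = q.[x].
  rewrite -[p](subrK p.[x]%:P) pq derivD derivC addr0 derivM derivXsubC mulr1.
  by rewrite hornerD hornerM hornerXsubC subrr mulr0 add0r.
have : q.[y] @[y --> within (segm R) x^'] --> q.[x].
  apply: cvg_within_filter; apply: cvg_within_filter.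
  exact: continuous_horner.
apply: cvg_trans; apply: near_eq_cvg.
rewrite near_withinE near_withinE; near=> y => yx _.
rewrite /diffquo.
have -> : p.[y] - p.[x] = q.[y] * (y - x).
  by have /(congr1 (horner^~ y)) := pq; rewrite !hornerE.
by rewrite mulfK // subr_eq0.
Unshelve. all: by end_near. Qed.

Lemma is_derive_within_continuous f x l : is_derive_within f x l ->
  f @ within (segm R) (nbhs x) --> f x.
Proof.
move=> fl; apply/cvgrPdist_lt => e e0.
move/cvgrPdist_lt: (fl) => /(_ _ ltr01).
rewrite !near_withinE => fl1.
near=> y => Sy.
have [->|yx] := eqVneq y x; first by rewrite subrr normr0.
have q1 : `|l - diffquo f x y| < 1.
  by move: yx Sy; near: y.
have q2 : `|diffquo f x y| <= `|l| + 1.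
  rewrite (le_trans _ (lerD (lexx `|l|) (ltW q1)))//.
  rewrite [X in `|X|](_ : _ = l - (l - diffquo f x y)); last by ring.
  exact: ler_normB.
have l1 : 0 < `|l| + 1 by rewrite ltr_wpDl.
have -> : f x - f y = diffquo f x y * (x - y).
  have yx0 : y - x != 0 by rewrite subr_eq0.
  by rewrite /diffquo; field.
rewrite normrM.
apply: (le_lt_trans (ler_wpM2r (normr_ge0 _) q2)).
rewrite mulrC -ltr_pdivlMr//.
near: y.
apply: (@cvgr_dist_lt _ _ _ (nbhs x) _ id x); first exact: cvg_id.
by rewrite divr_gt0.
Unshelve. all: by end_near. Qed.

(** [segm R] is a neighbourhood of each interior point, so that there the
    derivative within it is the ordinary one. *)
Lemma is_derive_within_interior f x l : -1 < x < 1 -> is_derive_within f x l ->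
  is_derive x (1 : R) f l.
Proof.
move=> /andP[x1 x2] fl.
suff h : h^-1 *: ((f \o shift x) h%:A - f x) @[h --> 0^'] --> l.
  by constructor; [exact: cvgP h|exact: cvg_lim].
apply/cvgrPdist_lt => e e0.
move/cvgrPdist_lt: (fl) => /(_ _ e0).
rewrite !near_withinE.
have : \forall y \near x, segm R y.
  have : x \in `](-1), 1[%R by rewrite in_itv /= x1.
  move=> /near_in_itvoo; apply: filterS => y; rewrite in_itv /= => /andP[??].
  by rewrite segmE !ltW.
move=> Sx fx; have /nbhs0P : \forall y \near x, segm R y /\
    (y != x -> segm R y -> `|l - diffquo f x y| < e) by exact: filterI Sx fx.
apply: filterS => h /=[Sh +] h0.
rewrite -subr_eq0.
have -> : diffquo f x (x + h) = h^-1 *: (f (h%:A + x) - f x).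
  by rewrite /diffquo [x + h]addrC addrK [h%:A]mulr1 mulrC.
apply => //.
by move: h0; apply: contra_neq; lra.
Qed.

Lemma rolle_within f f' a b : -1 <= a -> a < b -> b <= 1 ->
  (forall x, segm R x -> is_derive_within f x (f' x)) -> f a = f b ->
  exists2 c, a < c < b & f' c = 0.
Proof.
move=> a1 ab b1 df fab.
have [x||c] := @Rolle R f a b ab _ _ fab.
- rewrite in_itv /= => /andP[ax xb].
  have := @is_derive_within_interior f x (f' x); case => //.
    by rewrite (le_lt_trans a1)// (lt_le_trans xb).
  by apply: df; rewrite segmE; lra.
- apply: (@continuous_subspaceW _ _ _ (segm R)).
    by move=> x; rewrite segmE /= in_itv /=; lra.
  apply/subspace_continuousP => x Sx.
  exact: is_derive_within_continuous (df _ Sx).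
- rewrite in_itv /= => /andP[ac cb] [_ fc0].
  exists c; rewrite ?ac//.
  have /is_derive_within_interior : is_derive_within f c (f' c).
    by apply: df; rewrite segmE; lra.
  by case=> [|_ <-//]; lra.
Qed.

(** Rolle's theorem separates consecutive zeros of F k by zeros of F (k + 1), so
    that each step costs one zero and the n + 1 zeros of F 0 leave one of F n.
    F is any chain of successive derivatives, so that it can be assembled term
    by term from the derivatives of a function and those of a polynomial. *)
Lemma iter_rolle n (F : nat -> R -> R) (z : nat -> R) :
  (forall k x, (k < n)%N -> segm R x -> is_derive_within (F k) x (F k.+1 x)) ->
  (forall i, (i <= n)%N -> segm R (z i) /\ F 0%N (z i) = 0) ->
  (forall i, (i < n)%N -> z i < z i.+1) ->
  exists2 x, segm R x & F n x = 0.
Proof.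
elim: n F z => [|n IHn] F z dF z0 zlt.
  by have [] := z0 0%N (leqnn _); exists (z 0%N).
have /choice[w wP] : forall i, exists x, (i <= n)%N ->
    z i < x < z i.+1 /\ F 1%N x = 0.
  move=> i; have [ilen|] := leqP i n; last by exists 0.
  have [Szi Fi] := z0 i (leqW ilen).
  have [Szi1 Fi1] := z0 i.+1 ilen.
  move: Szi Szi1; rewrite !segmE => /andP[l _] /andP[_ u].
  have [|c cI Fc] := rolle_within l (zlt i ilen) u (fun x => dF 0%N x isT).
    by rewrite Fi Fi1.
  by exists c.
apply: (IHn (fun k => F k.+1) w).
- by move=> k x kn; exact: dF.
- move=> i ilen; have [/andP[l u] Fi] := wP i ilen; split=> //.
  have [+ _] := z0 i (leqW ilen); have [+ _] := z0 i.+1 ilen.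
  by rewrite !segmE; lra.
- move=> i iltn; have [/andP[_ u] _] := wP i (ltnW iltn).
  by have [/andP[l _] _] := wP i.+1 iltn; exact: lt_trans u l.
Qed.

Lemma iter_rolle_uniq n (F : nat -> R -> R) (s : seq R) :
  (forall k x, (k < n)%N -> segm R x -> is_derive_within (F k) x (F k.+1 x)) ->
  uniq s -> size s = n.+1 ->
  (forall x, x \in s -> segm R x /\ F 0%N x = 0) ->
  exists2 x, segm R x & F n x = 0.
Proof.
move=> dF us ss s0.
apply: (@iter_rolle n F (nth 0 (sort <=%O s))) => //.
- by move=> i ilen; apply: s0; rewrite -(mem_sort <=%O) mem_nth// size_sort ss.
- move=> i iltn.
  have st : sorted <%O (sort <=%O s) by rewrite sort_lt_sorted.
  apply: (sorted_ltn_nth lt_trans) => //; rewrite inE size_sort ss ltnS //.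
  exact: ltnW.
Qed.

(** The equality is only claimed on [-1, 1]; this is enough for the induction
    because the derivative within [-1, 1] at a point of [-1, 1] is determined
    by the values on [-1, 1] ([eq_is_derive_within]). *)
Lemma deriven_within_horner p k x : segm R x ->
  deriven_within (segm R) k (horner p) x = p^`(k).[x].
Proof.
elim: k x => [//|k IHk] x Sx.
rewrite /deriven_within iterS derivnS; apply: is_derive_within_lim => //.
refine (eq_is_derive_within _ Sx (@is_derive_within_horner p^`(k) x)) => y.
by rewrite inE => Sy; rewrite -IHk.
Qed.

End WithinDerivative.

(** * The worst error in terms of the node polynomial *)

Lemma derivn_monic (R : nzRingType) (p : {poly R}) n :
  p \is monic -> size p = n.+1 -> p^`(n) = (n`!)%:R%:P.
Proof.
move=> /monicP p1 sp; apply/polyP => i.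
rewrite coef_derivn coefC; case: i => [|i] /=.
  by rewrite addn0 ffactnn -[n in p`_n]/(n.+1.-1) -sp -lead_coefE p1.
by rewrite nth_default ?mul0rn// sp addnS ltnS leq_addr.
Qed.

Section NodePolynomial.
Context {R : realType} {s : nat}.
Implicit Types (c : 'I_s.+1 -> R) (f : R -> R).

Definition node_poly c : {poly R} := \prod_(i < s.+1) ('X - (c i)%:P).

Lemma monic_node_poly c : node_poly c \is monic.
Proof. exact: monic_prod_XsubC. Qed.

Lemma size_node_poly c : size (node_poly c) = s.+2.
Proof. by rewrite size_prod_XsubC /index_enum -enumT size_enum_ord. Qed.

Lemma root_node_poly c x : root (node_poly c) x = [exists i, x == c i].
Proof.
rewrite rootE horner_prod; apply/prodf_eq0/existsP => [[i _]|[i]];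
  by rewrite ?hornerXsubC ?subr_eq0 => xc; exists i;
    rewrite ?hornerXsubC ?subr_eq0.
Qed.

Lemma derivn_node_poly c : (node_poly c)^`(s.+1) = (s.+1)`!%:R%:P.
Proof. by rewrite (derivn_monic (monic_node_poly c)) ?size_node_poly. Qed.

Lemma nodes_inj c : nodes c -> injective c.
Proof.
case=> _ _ clt i j cij; have [/clt|/clt|/val_inj//] := ltngtP i j;
  by rewrite cij ltxx.
Qed.

Lemma nodes_segm c i : nodes c -> segm R (c i).
Proof.
case=> c0 c1 clt; rewrite segmE -c0 -c1; apply/andP; split.
- have [->//|i0] := eqVneq i ord0.
  by apply/ltW/clt; rewrite lt0n.
- have [->//|i1] := eqVneq i ord_max.
  by apply/ltW/clt; rewrite ltn_neqAle -val_eqE/= in i1 *;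
    rewrite i1 -ltnS ltn_ord.
Qed.

(** For x not a node and w the node polynomial, the function
      t |-> f t * w x - (w x * L t + (f x - L x) * w t)
    vanishes at x and at the s + 1 nodes, hence its derivative of order s + 1
    vanishes at some t; that derivative is
      f^(s+1)(t) * w x - (f x - L x) * (s + 1)!. *)
Lemma interp_error M c f x : nodes c -> CnM s.+1 M f -> segm R x ->
  `|f x - (lagrange_interp c f).[x]| <= M / (s.+1)`!%:R * `|(node_poly c).[x]|.
Proof.
move=> cN [[df _] fM] Sx.
have Lc i := lagrange_interp_sample f cN i.
have [/existsP[i /eqP ->]|xc] := boolP [exists i, x == c i].
  have := root_node_poly c (c i); rewrite rootE.
  have -> : [exists j, c i == c j] by apply/existsP; exists i.
  by move=> /eqP ->; rewrite Lc subrr normr0 mulr0.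
set L := lagrange_interp c f in Lc *.
set w := (node_poly c).[x]; set e := f x - L.[x].
have w0 : w != 0 by rewrite -rootE root_node_poly.
pose P := w *: L + e *: node_poly c.
pose F k t := deriven_within (segm R) k f t * w - P^`(k).[t].
have wc i : (node_poly c).[c i] = 0.
  by apply/rootP; rewrite root_node_poly; apply/existsP; exists i.
have [|||t tx|t St Ft] :=
  @iter_rolle_uniq R s.+1 F (x :: [seq c i | i <- enum 'I_s.+1]).
- move=> k t ks St; rewrite /F derivnS.
  apply: is_derive_withinB; last exact: is_derive_within_horner.
  apply: is_derive_withinZ.
  exact: derivable_within_is_derive_within (df k ks t St).
- rewrite /= map_inj_uniq ?enum_uniq ?andbT//; last exact: nodes_inj.
  by apply: contra xc => /mapP[i _ ->]; apply/existsP; exists i.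
- by rewrite /= size_map size_enum_ord.
- rewrite /F /P /deriven_within /= !hornerE.
  move: tx; rewrite inE => /predU1P[->|/mapP[i _ ->]].
    by split=> //; rewrite -/w /e; ring.
  split; first exact: nodes_segm.
  by rewrite Lc wc; ring.
have : `|deriven_within (segm R) s.+1 f t| <= M.
  rewrite -lee_fin; apply: le_trans fM; apply: ereal_sup_ubound.
  by exists t.
have -> : deriven_within (segm R) s.+1 f t = e * (s.+1)`!%:R / w.
  move/eqP : Ft; rewrite /F /P derivnD !derivnZ derivn_node_poly.
  rewrite (derivn_poly0 (size_lagrange_interp _ _)) scaler0 add0r !hornerE.
  by rewrite subr_eq0 => /eqP <-; rewrite mulfK.
rewrite !normrM normfV normr_nat ler_pdivrMr ?normr_gt0// mulrAC.
by rewrite ler_pdivlMr// ltr0n fact_gt0.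
Qed.

Lemma worst_error_le M c K : 0 <= M -> nodes c ->
  (forall x, segm R x -> `|(node_poly c).[x]| <= K) ->
  (worst_error M c <= (M / (s.+1)`!%:R * K)%:E)%E.
Proof.
move=> M0 cN wK; apply: ge_ereal_sup => _ [f fM <-].
apply: ge_ereal_sup => _ [x Sx <-]; rewrite lee_fin.
apply: (le_trans (interp_error cN fM Sx)).
by rewrite ler_wpM2l ?wK// divr_ge0.
Qed.

Lemma horner_CnM n M (p : {poly R}) : 0 <= M -> p^`(n) = M%:P ->
  CnM n M (horner p).
Proof.
move=> M0 pn; split; [split|].
- move=> k kn x Sx; apply/cvg_ex; exists p^`(k.+1).[x]; rewrite derivnS.
  refine (@eq_is_derive_within _ _ (deriven_within (segm R) k (horner p)) x _ _
    Sx (@is_derive_within_horner _ p^`(k) x)) => y.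
  by rewrite inE => Sy; rewrite deriven_within_horner.
- apply: (@subspace_eq_continuous _ _ _ (cst M)); last by move=> x; exact: cvg_cst.
  move=> x; rewrite inE => Sx; apply/esym.
  by apply: (etrans (deriven_within_horner p n Sx)); rewrite pn hornerC.
- apply: ge_ereal_sup => _ [x Sx <-]; rewrite lee_fin.
  by rewrite deriven_within_horner// pn hornerC ger0_norm.
Qed.

(** The node polynomial, scaled to have its derivative of order s + 1 equal to
    M, is its own interpolation error, as it vanishes at all the nodes. *)
Lemma worst_error_ge M c x : 0 <= M -> segm R x ->
  ((M / (s.+1)`!%:R * `|(node_poly c).[x]|)%:E <= worst_error M c)%E.
Proof.
move=> M0 Sx; set m := M / _.
have m0 : 0 <= m by rewrite divr_ge0.
pose f := horner (m *: node_poly c).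
apply: (@le_trans _ _ (sup_norm (fun t => f t - (lagrange_interp c f).[t]))).
  apply: ereal_sup_ubound; exists x => //.
  suff -> : lagrange_interp c f = 0.
    by rewrite horner0 subr0 /f hornerZ normrM ger0_norm.
  rewrite /lagrange_interp big1// => i _.
  suff -> : f (c i) = 0 by rewrite scale0r.
  rewrite /f hornerZ (_ : (node_poly c).[c i] = 0) ?mulr0//.
  by apply/rootP; rewrite root_node_poly; apply/existsP; exists i.
apply: ereal_sup_ubound; exists f => //.
apply: horner_CnM => //.
by rewrite derivnZ derivn_node_poly -mul_polyC -polyCM /m divfK.
Qed.

End NodePolynomial.

(** * Alternation and Chebyshev polynomials *)

(** The sign changes give a root of p in each of the s - 1 intervals
    ]y (k + 1), y k[, which with -1 and 1 makes s + 1 distinct roots: p = 0,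
    against the strict sign at y 1. *)
Lemma alternation_absurd (R : rcfType) (p : {poly R}) s (y : nat -> R) :
  (0 < s)%N -> (size p <= s.+1)%N -> root p (-1) -> root p 1 ->
  (forall k, (0 < k <= s)%N -> -1 < y k < 1) ->
  (forall k, (0 < k < s)%N -> y k.+1 < y k) ->
  (forall k, (0 < k <= s)%N -> 0 < (-1) ^+ k * p.[y k]) ->
  False.
Proof.
move=> s0 sp pN1 p1 yI ydecr py.
suff p0 : p = 0 by have := py 1%N s0; rewrite p0 horner0 mulr0 ltxx.
(* r 0 = 1, r s = -1, and r k is the root between y (k + 1) and y k *)
have /choice[r rP] : forall k, exists x, (k <= s)%N ->
    [/\ root p x, (k < s)%N -> y k.+1 < x & (0 < k)%N -> x < y k].
  move=> k; have [-> {k}|k0] := posnP k.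
    by exists 1; split=> //; have /andP[] := yI 1%N s0.
  have [ks|sk|->] := ltngtP k s.
  - have /ydecr yk : (0 < k < s)%N by rewrite k0.
    have [|x xI px] := @poly_ivtoo _ p _ _ (ltW yk).
      have pk := py k; have pk1 := py k.+1.
      rewrite k0 ltnW// in pk; rewrite ks in pk1.
      have := mulr_gt0 (pk1 isT) (pk isT).
      by rewrite exprS mulN1r !mulNr oppr_gt0 mulrACA -expr2 sqrr_sign mul1r.
    by move: xI; rewrite in_itv /= => /andP[? ?]; exists x; split.
  - by exists 0.
  - exists (-1); split=> // _.
    by have := yI s; rewrite s0 leqnn => /(_ isT)/andP[].
apply: (@roots_geq_poly_eq0 _ _ (mkseq r s.+1)); last by rewrite size_mkseq.
- apply/allP => _ /mapP[k + ->]; rewrite mem_iota ltnS => /rP[].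
  by [].
- apply: (@sorted_uniq _ >%O); first exact: rev_trans lt_trans.
    by move=> x; exact: ltxx.
  apply/(sortedP 0) => k; rewrite size_mkseq ltnS => ks.
  rewrite !nth_mkseq ?ltnS//; last exact: ltnW.
  have [_ /(_ ks) + _] := rP k (ltnW ks); have [_ _ /(_ isT)] := rP k.+1 ks.
  exact: lt_trans.
Qed.

Section Chebyshev.
Context {R : realType}.

Fixpoint chebyshev n : {poly R} :=
  if n is n1.+1 then
    if n1 is n2.+1 then 2 *: ('X * chebyshev n1) - chebyshev n2 else 'X
  else 1.

Lemma chebyshevSS n :
  chebyshev n.+2 = 2 *: ('X * chebyshev n.+1) - chebyshev n.
Proof. by []. Qed.

(** The recurrence is the identity
    cos ((n + 2) t) = 2 cos t cos ((n + 1) t) - cos (n t). *)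
Lemma horner_chebyshev n (t : R) : (chebyshev n).[cos t] = cos (t *+ n).
Proof.
suff : (chebyshev n).[cos t] = cos (t *+ n) /\
    (chebyshev n.+1).[cos t] = cos (t *+ n.+1).
  by case.
elim: n => [|n [IH0 IH1]].
  by rewrite mulr0n mulr1n cos0 /= !hornerE.
split=> //; rewrite chebyshevSS hornerD hornerN hornerZ hornerM hornerX IH0 IH1.
have -> : t *+ n = t *+ n.+1 - t by rewrite mulrSr addrK.
by rewrite [t *+ n.+2]mulrSr cosB cosD; ring.
Qed.

Lemma size_lead_chebyshev n :
  size (chebyshev n.+1) = n.+2 /\ lead_coef (chebyshev n.+1) = 2 ^+ n.
Proof.
suff : size (chebyshev n) = n.+1 /\
    (size (chebyshev n.+1) = n.+2 /\ lead_coef (chebyshev n.+1) = 2 ^+ n) by case.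
elim: n => [|n [IH0 [IH1 IHl]]].
  by rewrite /= size_polyX size_poly1 lead_coefX.
have sX : size (2 *: ('X * chebyshev n.+1)) = n.+3.
  rewrite size_scale ?pnatr_eq0// mulrC size_mulX ?IH1//.
  by rewrite -size_poly_eq0 IH1.
have lt : (size (- chebyshev n) < size (2 *: ('X * chebyshev n.+1)))%N.
  by rewrite size_polyN IH0 sX.
split=> //; rewrite chebyshevSS size_polyDl// lead_coefDl//; split=> //.
by rewrite lead_coefZ lead_coefM lead_coefX mul1r IHl exprS.
Qed.

Lemma chebyshev_le1 n (x : R) : -1 <= x <= 1 -> `|(chebyshev n).[x]| <= 1.
Proof.
by move=> xI; rewrite -[x]acosK ?in_itv// horner_chebyshev cos_max.
Qed.

Context {s : nat} (s_gt0 : (0 < s)%N).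

(* In the variable x = cos t the roots of T_n are at the odd multiples of d
   and its extrema at the even multiples. *)
Let n := s.+1.
Let d : R := pi / (2 * n)%:R.
Let a : R := cos d.
Let c := @cheb_nodes R s.

Let d_gt0 : 0 < d.
Proof. by rewrite divr_gt0 ?pi_gt0// ltr0n. Qed.

Let dMnn : d *+ (2 * n) = pi.
Proof. by rewrite -mulr_natr divfK// pnatr_eq0. Qed.

Let dMn : d *+ n = pi / 2.
Proof. by rewrite -dMnn mulnC mulrnA mulr2n; field. Qed.

Let cos_lt (u v : nat) : (u < v)%N -> (v <= 2 * n)%N ->
  cos (d *+ v) < cos (d *+ u).
Proof.
move=> uv vn; have dI w : (w <= 2 * n)%N -> d *+ w \in `[0, pi].
  by move=> wn; rewrite in_itv /= -dMnn ler_pMn2l// wn mulrn_wge0 ?(ltW d_gt0).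
rewrite ltr_cos; [by rewrite ltr_pMn2l| |exact: dI].
exact/dI/(leq_trans (ltnW uv)).
Qed.

Let cosBd (u : nat) : (u <= 2 * n)%N -> cos (d *+ (2 * n - u)) = - cos (d *+ u).
Proof.
by move=> un; rewrite mulrnBr// dMnn addrC cosDpi cosN.
Qed.

Let a_gt0 : 0 < a.
Proof.
have := @cos_lt 1 n; rewrite mulr1n dMn cos_pihalf; apply => //.
by rewrite leq_pmull.
Qed.

Let a_neq0 : a != 0. Proof. by rewrite gt_eqF. Qed.

Let cheb_nodesE i : a * c i = - cos (d *+ (2 * i + 1)).
Proof.
rewrite /c /cheb_nodes -/n -/d -/a mulrN mulrCA divff// mulr1.
by rewrite mulrAC -mulrA mulr_natl.
Qed.

Lemma cheb_nodes_nodes : nodes c.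
Proof.
split.
- by apply: (mulfI a_neq0); rewrite cheb_nodesE muln0 add0n mulr1n mulrN1.
- apply: (mulfI a_neq0); rewrite cheb_nodesE /= mulr1.
  have -> : (2 * s + 1 = 2 * n - 1)%N by rewrite /n; lia.
  by rewrite cosBd// opprK mulr1n.
- move=> i j ij; rewrite -(ltr_pM2l a_gt0) !cheb_nodesE ltrN2; apply: cos_lt.
    by lia.
  by have := ltn_ord j; rewrite /n; lia.
Qed.

Let root_cheb_nodes i : (chebyshev n).[a * c i] = 0.
Proof.
rewrite cheb_nodesE -cosDpi horner_chebyshev.
have -> : (d *+ (2 * i + 1) + pi) *+ n = pi / 2 + pi *+ (i + n).
  rewrite -dMn -dMnn -[in RHS]mulrnA -!mulrnDr -mulrnA; congr (_ *+ _).
  by lia.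
by rewrite (alternatingn (@cosDpi R)) cos_pihalf mulr0.
Qed.

Let kappa : R := (2 ^+ s * a ^+ n)^-1.

Let kappa_gt0 : 0 < kappa.
Proof. by rewrite invr_gt0 mulr_gt0// exprn_gt0. Qed.

(** T_n (a x) has degree n and vanishes at the n scaled nodes; its leading
    coefficient is 1 / kappa. *)
Lemma horner_node_poly_cheb x :
  (node_poly c).[x] = kappa * (chebyshev n).[a * x].
Proof.
have [sn ln] := size_lead_chebyshev s.
have saX : size (a *: 'X) = 2 by rewrite size_scale// size_polyX.
have E : chebyshev n \Po (a *: 'X) = kappa^-1 *: node_poly c.
  have /all_roots_prod_XsubC : size (chebyshev n \Po (a *: 'X)) =
      (size [seq c i | i <- index_enum 'I_n]).+1.
    by rewrite size_comp_poly2// sn size_map /index_enum -enumT size_enum_ord.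
  rewrite big_map -/(node_poly c) => ->.
  - rewrite lead_coef_comp ?saX// sn ln lead_coefZ lead_coefX mulr1 /=.
    by rewrite /kappa invrK.
  - apply/allP => _ /mapP[i _ ->].
    by rewrite rootE horner_comp hornerZ hornerX root_cheb_nodes.
  - rewrite uniq_rootsE map_inj_uniq ?/index_enum -?enumT ?enum_uniq//.
    exact/nodes_inj/cheb_nodes_nodes.
have := congr1 (horner^~ x) E; rewrite horner_comp !hornerZ hornerX => ->.
by rewrite mulVKf// gt_eqF.
Qed.

Lemma node_poly_cheb_le x : segm R x -> `|(node_poly c).[x]| <= kappa.
Proof.
rewrite segmE => xI; rewrite horner_node_poly_cheb normrM gtr0_norm//.
rewrite ger_pMr// chebyshev_le1//.
have a1 : a <= 1 by exact: cos_le1.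
by have := a_gt0; nra.
Qed.

(** Were |w_b| < kappa on [-1, 1], the difference of the two node polynomials
    would have at each y j the sign (-1)^j of the extremal value there; being
    the difference of two monic polynomials of degree s + 1, it has degree at
    most s. *)
Lemma node_poly_ge (b : 'I_n -> R) : nodes b ->
  exists2 x, segm R x & kappa <= `|(node_poly b).[x]|.
Proof.
move=> bN; apply: contrapT => no.
have {}no x : segm R x -> `|(node_poly b).[x]| < kappa.
  by move=> Sx; rewrite ltNge; apply/negP => le_kappa; apply: no; exists x.
pose y j := cos (d *+ (2 * j)) / a.
have yI j : (0 < j <= s)%N -> -1 < y j < 1.
  move=> j0s; rewrite /y ltr_pdivlMr// ltr_pdivrMr// mulN1r mul1r.
  (* 2 j lies strictly between 1 and 2 n - 1, where cos takes values a, -a *)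
  have := @cosBd 1 isT; have := @cos_lt 1 (2 * j); rewrite mulr1n => lt <-.
  by rewrite lt ?cos_lt// /n; lia.
have root1 (e : 'I_n -> R) i : nodes e -> root (node_poly e) (e i).
  by move=> eN; rewrite root_node_poly; apply/existsP; exists i.
have cN := cheb_nodes_nodes.
have [c0 c1 _] := cN; have [b0 b1 _] := bN.
apply: (@alternation_absurd _ (node_poly c - node_poly b) s y) => //.
- apply/leq_sizeP => j; rewrite coefB leq_eqVlt => /predU1P[<-|sj].
    have /monicP := monic_node_poly c; have /monicP := monic_node_poly b.
    by rewrite !lead_coefE !size_node_poly => -> ->; rewrite subrr.
  by rewrite !nth_default ?size_node_poly// subrr.
- have := root1 _ ord0 cN; have := root1 _ ord0 bN; rewrite c0 b0 !rootE.
  by rewrite hornerD hornerN => /eqP-> /eqP->; rewrite subrr.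
- have := root1 _ ord_max cN; have := root1 _ ord_max bN; rewrite c1 b1 !rootE.
  by rewrite hornerD hornerN => /eqP-> /eqP->; rewrite subrr.
- move=> j js; rewrite /y ltr_pM2r ?invr_gt0//; apply: cos_lt; rewrite /n; lia.
- move=> j js; rewrite hornerD hornerN horner_node_poly_cheb.
  have -> : a * y j = cos (d *+ (2 * j)) by rewrite /y mulrC divfK.
  rewrite horner_chebyshev.
  have -> : d *+ (2 * j) *+ n = 0 + pi *+ j.
    by rewrite add0r -dMnn -!mulrnA; congr (_ *+ _); lia.
  rewrite (alternatingn (@cosDpi R)) cos0 mulr1 mulrBr mulrCA -expr2 sqrr_sign.
  rewrite mulr1 subr_gt0; apply: le_lt_trans (ler_norm _) _.
  by rewrite normrM normr_sign mul1r no// segmE; have := yI j js; lra.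
Qed.

End Chebyshev.

Unset Implicit Arguments.
Set Strict Implicit.
Set Printing Implicit Defensive.

Theorem theorem2p3 (R : realType) (s : nat) (M : R) (hs : (1 <= s)%N)
    (hM : 0 < M) :
  nodes (@cheb_nodes R s) /\
  lbound [set worst_error M c | c in @nodes R s]
         (worst_error M (@cheb_nodes R s)).
Proof.
split; first exact: cheb_nodes_nodes.
move=> _ [b bN <-].
have M0 := ltW hM.
have [x Sx kx] := node_poly_ge hs bN.
apply: le_trans (worst_error_ge b M0 Sx).
apply: le_trans (worst_error_le M0 (cheb_nodes_nodes hs) (node_poly_cheb_le hs)) _.
by rewrite lee_fin ler_wpM2l// divr_ge0.
Qed.
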